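(* Let $\langle X, \phi \rangle$ be a finite closure system, let $E$ be an essential set of $\langle X, \phi \rangle$, and let $\Sigma$ be an optimal basis for $\langle X, \phi \rangle$. If $A_1 \rightarrow B_1, \dots, A_n \rightarrow B_n$ are all the (distinct) implications in $\Sigma$ with $\phi(A_i) = E$, then $s = |B_1| + \dots + |B_n|$ is fixed, i.e. $s$ does not depend on the choice of the optimal basis $\Sigma$: for any two optimal bases $\Sigma, \Sigma'$ of $\langle X, \phi \rangle$, $$\sum_{(A \rightarrow B) \in \Sigma,\ \phi(A) = E} |B| \;=\; \sum_{(A \rightarrow B) \in \Sigma',\ \phi(A) = E} |B|.$$
   Context: A closure system $\langle X, \phi \rangle$ is a nonempty set $X$ equipped with a closure operator $\phi: \mathcal{P}(X) \to \mathcal{P}(X)$, i.e. a map such that for all $A, B \subseteq X$: $A \subseteq \phi(A)$; $A \subseteq B$ implies $\phi(A) \subseteq \phi(B)$; and $\phi(\phi(A)) = \phi(A)$. It is finite if $X$ is finite. A set $A \subseteq X$ is closed if $A = \phi(A)$; let $F$ denote the family of closed sets, which contains $X$ and is closed under intersection. An implication on $X$ is an ordered pair of sets $A, B \subseteq X$, denoted $A \rightarrow B$. A set $S \subseteq X$ obeys $A \rightarrow B$ if $A \not\subseteq S$ or $B \subseteq S$. A set $\Sigma$ of implications on $X$ is an implication basis for $\langle X, \phi \rangle$ if the family of subsets of $X$ that obey all implications in $\Sigma$ is exactly the family $F$ of closed sets of $\langle X, \phi \rangle$. An optimal basis for $\langle X, \phi \rangle$ is an implication basis $\Sigma$ for which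 the sum of all cardinalities of the left and right sides of all implications, $\sum_{(A \rightarrow B) \in \Sigma} (|A| + |B|)$, is minimal among all implication bases for $\langle X, \phi \rangle$. A set $Q \subseteq X$ is quasi-closed (associated with $\langle X, \phi \rangle$) if $Q \notin F$ and $F \cup \{Q\}$ is still closed under set intersection, i.e. for every $S \in F$, $S \supseteq Q$ or $S \cap Q \in F$. An essential set of $\langle X, \phi \rangle$ is a set of the form $\phi(Q)$ with $Q$ quasi-closed. *)

(* Defs.v *)
From mathcomp Require Import all_boot.

Set Implicit Arguments.
Unset Strict Implicit.
Unset Printing Implicit Defensive.

Section ClosureSystems.

(* The nonemptiness of the ground set X is not built in. *)
Variable X : finType.
Implicit Types (A B S Q E : {set X}) (phi : {set X} -> {set X}).

Definition closure_operator phi : Prop :=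
  [/\ forall A, A \subset phi A,
      forall A B, A \subset B -> phi A \subset phi B
    & forall A, phi (phi A) = phi A].

Definition closed_sets phi : {set {set X}} := [set A | A == phi A].

(* The pair (A, B) is the implication A -> B. *)
Definition implication : finType := ({set X} * {set X})%type.
Implicit Types (i : implication) (Sigma : {set implication}).

Definition obeys S i : bool := ~~ (i.1 \subset S) || (i.2 \subset S).

Definition implication_basis phi Sigma : Prop :=
  [set S | [forall i in Sigma, obeys S i]] = closed_sets phi.

Definition basis_size Sigma : nat := \sum_(i in Sigma) (#|i.1| + #|i.2|).

Definition optimal_basis phi Sigma : Prop :=
  implication_basis phi Sigma /\
  forall Sigma', implication_basis phi Sigma' ->
    basis_size Sigma <= basis_size Sigma'.

Definition quasi_closed phi Q : Prop :=
  Q \notin closed_sets phi /\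
  {in Q |: closed_sets phi &, forall S T, S :&: T \in Q |: closed_sets phi}.

Lemma quasi_closedP phi Q : closure_operator phi ->
  quasi_closed phi Q <->
  Q \notin closed_sets phi /\
  (forall S, S \in closed_sets phi ->
     (Q \subset S) \/ (S :&: Q \in closed_sets phi)).
Proof.
move=> [ext mono _]; split=> -[nFQ capF]; split=> //.
  move=> S FS.
  have := capF S Q (setU1r Q FS) (setU11 Q _).
  rewrite in_setU1 => /orP[/eqP eqQ|]; [left|by right].
  by rewrite -eqQ subsetIl.
have capQ S : S \in closed_sets phi -> S :&: Q \in Q |: closed_sets phi.
  by move=> /capF[/setIidPr->|FSQ]; [exact: setU11 | exact: setU1r].
move=> S T; rewrite 2!in_setU1.
move=> /predU1P[->|FS] /predU1P[->|FT].
- by rewrite setIid setU11.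
- by rewrite setIC capQ.
- exact: capQ.
apply: setU1r; move: FS FT; rewrite !inE => /eqP FS /eqP FT.
rewrite eqEsubset ext subsetI.
by rewrite {2}FS {3}FT !mono ?subsetIl ?subsetIr.
Qed.

Definition essential phi E : Prop := exists2 Q, quasi_closed phi Q & E = phi Q.

End ClosureSystems.

(* Main.v *)
Require Import Defs.
From mathcomp Require Import all_boot zify.

Set Implicit Arguments.
Unset Strict Implicit.
Unset Printing Implicit Defensive.

(** Call a set S lower closed (with respect to E) if it contains phi C whenever
    it contains C and phi C is a proper subset of E; let kappa A be the least
    lower closed set containing A.  The implications of a basis whose left side
    has closure properly inside E cut out exactly the lower closed sets
    ([basis_lower_closed]), so kappa does not depend on the basis, and those
    implications stay put when only the block at E, i.e. the implications
    A -> B with phi A = E, is modified.  Modulo the implications below E, a left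
    side A of the block matters only through kappa A.

    - The block at E of one basis can be replaced by that of another basis
      ([basis_exchange]).  So the blocks at E of two optimal bases have the same
      total size, left and right sides together.

    - The left sides alone also have the same total size.  Take A -> B in the
      block at E of an optimal basis, with A nonempty.  Then kappa A is not E,
      since otherwise the implication could be dropped.  Hence kappa A is not
      closed and violates some A' -> B' of the block at E of the second basis.
      Likewise kappa A', which lies inside kappa A, violates some A1 -> B1 of
      the block of the first basis.  As A1 is included in kappa A, the
      implications A1 -> B1 and A -> B could be merged into A1 -> B1 :|: B,
      saving the size of A; so they coincide, and kappa A' = kappa A.  Then A
      can be replaced by A', whence #|A| <= #|A'|.  Sending A -> B to A' -> B'
      is injective, again because implications with the same kappa could be
      merged.

    Subtracting the second equality from the first gives the theorem. *)

(** * Lower closed sets and modifications of a basis *)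

Section LowerClosedSets.

Variables (X : finType) (phi : {set X} -> {set X}) (E : {set X}).
Hypothesis phi_closure : closure_operator phi.
Implicit Types (A C Q S : {set X}) (i j k : implication X).
Implicit Types (Sigma T : {set implication X}).

Lemma closure_sub A S : S \in closed_sets phi -> A \subset S -> phi A \subset S.
Proof.
by case: phi_closure => _ mono _; rewrite inE => /eqP FS /mono; rewrite -FS.
Qed.

Lemma closure_closed A : phi A \in closed_sets phi.
Proof. by case: phi_closure => _ _ idem; rewrite inE idem. Qed.

Lemma basisP Sigma : implication_basis phi Sigma <->
  (forall S, {in Sigma, forall i, obeys S i} <-> S \in closed_sets phi).
Proof.
split=> [basisS S|basisS].
  by rewrite -basisS inE; split=> [?|/forall_inP//]; apply/forall_inP.
by apply/setP=> S; rewrite [LHS]inE; apply/forall_inP/idP => /basisS.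
Qed.

Lemma closed_obeys Sigma S i : implication_basis phi Sigma ->
  S \in closed_sets phi -> i \in Sigma -> obeys S i.
Proof. by move=> /basisP basisS /basisS; apply. Qed.

Lemma basis_sub Sigma i :
  implication_basis phi Sigma -> i \in Sigma -> i.2 \subset phi i.1.
Proof.
case: phi_closure => ext _ _ /basisP basisS Si.
by have /basisS/(_ i Si) := closure_closed i.1; rewrite /obeys ext.
Qed.

Definition lower_closed S : bool :=
  [forall C : {set X}, (C \subset S) && (phi C \proper E) ==> (phi C \subset S)].

Lemma lower_closedP S :
  reflect (forall C, C \subset S -> phi C \proper E -> phi C \subset S)
          (lower_closed S).
Proof.
apply: (iffP forallP) => [lcS C sCS pCE|lcS C].
  by apply: (implyP (lcS C)); rewrite sCS.
by apply/implyP=> /andP[]; apply: lcS.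
Qed.

Lemma closed_lower_closed S : S \in closed_sets phi -> lower_closed S.
Proof. by move=> FS; apply/lower_closedP => C sCS _; apply: closure_sub. Qed.

(** If S obeys the implications below E and contains C with phi C below E, then
    S :&: phi C obeys the whole basis: only left sides with closure inside phi C
    are at stake.  So it is closed, and contains phi C. *)
Lemma basis_lower_closed Sigma S : implication_basis phi Sigma ->
  (forall i, i \in Sigma -> phi i.1 \proper E -> obeys S i) -> lower_closed S.
Proof.
move=> basisS obS; apply/lower_closedP => C sCS pCE.
suffices FSC : S :&: phi C \in closed_sets phi.
  have sCSC : C \subset S :&: phi C.
    by case: phi_closure => ext _ _; rewrite subsetI sCS ext.
  by have /subsetIP[] := closure_sub FSC sCSC.
apply/(basisP Sigma).1 => // i Si.
rewrite /obeys -implybE; apply/implyP; rewrite !subsetI => /andP[siS siC].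
have phiC : phi i.1 \subset phi C by apply: closure_sub (closure_closed C) siC.
have := obS i Si (sub_proper_trans phiC pCE).
by rewrite /obeys siS /= => ->; rewrite (subset_trans _ phiC) ?(basis_sub basisS).
Qed.

Lemma lower_closed_obeys Sigma S i : implication_basis phi Sigma ->
  lower_closed S -> i \in Sigma -> phi i.1 \proper E -> obeys S i.
Proof.
move=> basisS /lower_closedP lcS Si pE; rewrite /obeys -implybE; apply/implyP=> siS.
exact: subset_trans (basis_sub basisS Si) (lcS _ siS pE).
Qed.

Definition kappa A := \bigcap_(S : {set X} | lower_closed S && (A \subset S)) S.

Lemma sub_kappa A : A \subset kappa A.
Proof. by apply/bigcapsP=> S /andP[]. Qed.

Lemma kappa_sub A S : lower_closed S -> A \subset S -> kappa A \subset S.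
Proof. by move=> lcS sAS; apply: bigcap_inf; rewrite lcS. Qed.

Lemma lower_closed_kappa A : lower_closed (kappa A).
Proof.
apply/lower_closedP => C sCA pCE; apply/bigcapsP=> S /andP[lcS sAS].
apply: (lower_closedP _ lcS) => //; apply: subset_trans sCA _.
exact: kappa_sub.
Qed.

Lemma kappa_sub_closure A : kappa A \subset phi A.
Proof.
case: phi_closure => ext _ _.
exact: kappa_sub (closed_lower_closed (closure_closed A)) (ext A).
Qed.

Lemma closure_kappa A : phi (kappa A) = phi A.
Proof.
case: phi_closure => _ mono _; apply/eqP; rewrite eqEsubset.
by rewrite (closure_sub (closure_closed A)) ?kappa_sub_closure ?mono ?sub_kappa.
Qed.

(** A lower closed generator Q of E other than E is not closed, so it violates
    an implication of the basis.  The left side of the latter lies in Q, hence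
    its closure lies in E, and it is not below E because Q is lower closed. *)
Lemma violated_at Sigma Q : implication_basis phi Sigma ->
  lower_closed Q -> phi Q = E -> Q != E ->
  exists2 j, j \in Sigma & (phi j.1 == E) && (j.1 \subset Q).
Proof.
move=> basisS lcQ phiQ QE; apply/exists_inP; apply: contraNT QE => noj.
suffices: Q \in closed_sets phi by rewrite inE phiQ.
apply/(basisP Sigma).1 => // i Si.
rewrite /obeys -implybE; apply/implyP => siQ.
have: phi i.1 \subset E by rewrite -phiQ; case: phi_closure => _ mono _; apply: mono.
rewrite subEproper => /predU1P[eqE|pE].
  by case/exists_inP: noj; exists i; rewrite // eqE eqxx siQ.
by have := lower_closed_obeys basisS lcQ Si pE; rewrite /obeys siQ.
Qed.

(** The common criterion for all the modifications below: as long as the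
    implications below E are kept, only lower closed sets need to be tested. *)
Lemma basis_modify Sigma T : implication_basis phi Sigma ->
    (forall i, i \in Sigma -> phi i.1 \proper E -> i \in T) ->
    (forall S, S \in closed_sets phi -> {in T, forall i, obeys S i}) ->
    (forall S, lower_closed S -> {in T, forall i, obeys S i} ->
       {in Sigma, forall i, obeys S i}) ->
  implication_basis phi T.
Proof.
move=> basisS lowT soundT completeT; apply/basisP => S; split; last exact: soundT.
move=> obS; apply/(basisP Sigma).1 => //; apply: completeT => //.
by apply: (basis_lower_closed basisS) => i Si pE; apply/obS/lowT.
Qed.

(** If S is lower closed and obeys the block of T at E, then S :&: E obeys all
    of T, hence is closed.  So S contains E as soon as it contains a set with
    closure E, and then it obeys the block of Sigma at E. *)
Lemma basis_exchange Sigma T :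
    implication_basis phi Sigma -> implication_basis phi T ->
  implication_basis phi
    ([set i in Sigma | phi i.1 != E] :|: [set i in T | phi i.1 == E]).
Proof.
move=> basisS basisT; apply: (basis_modify basisS) => [i Si pE|S FS i|S lcS obS i Si].
- by rewrite !inE Si proper_neq.
- rewrite !inE => /orP[] /andP[memi _]; first exact: closed_obeys basisS FS memi.
  exact: closed_obeys basisT FS memi.
have [phiE|phinE] := eqVneq (phi i.1) E; last by apply: obS; rewrite !inE Si phinE.
rewrite /obeys -implybE; apply/implyP => siS.
have FE : E \in closed_sets phi by rewrite -phiE closure_closed.
have sBE : i.2 \subset E by rewrite -phiE (basis_sub basisS).
have siE : i.1 \subset E by case: phi_closure => ext _ _; rewrite -phiE.
suffices FSE : S :&: E \in closed_sets phi.
  have := closure_sub FSE (_ : i.1 \subset _).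
  by rewrite phiE !subsetI siS siE => /(_ isT)/andP[/(subset_trans sBE)].
apply/(basisP T).1 => // j Tj; rewrite /obeys -implybE !subsetI.
apply/implyP => /andP[sjS sjE].
have phijE := closure_sub FE sjE.
rewrite (subset_trans (basis_sub basisT Tj) phijE) andbT.
suffices: obeys S j by rewrite /obeys sjS.
move: phijE; rewrite subEproper => /predU1P[eqE|pE].
  by apply: obS; rewrite !inE Tj eqE eqxx orbT.
exact: lower_closed_obeys basisT _ _ _.
Qed.

Lemma basis_drop Sigma i : implication_basis phi Sigma ->
  i \in Sigma -> phi i.1 = E -> kappa i.1 = E ->
  implication_basis phi (Sigma :\ i).
Proof.
move=> basisS Si phiE kE; apply: (basis_modify basisS) => [j Sj pE|S FS j|S lcS obS j Sj].
- by rewrite in_setD1 Sj andbT; apply: contraTneq pE => ->; rewrite phiE properxx.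
- by rewrite in_setD1 => /andP[_]; apply: closed_obeys basisS FS.
have [->|nji] := eqVneq j i; last by apply: obS; rewrite in_setD1 nji.
rewrite /obeys -implybE; apply/implyP => /(kappa_sub lcS); rewrite kE.
by apply: subset_trans; rewrite -phiE (basis_sub basisS).
Qed.

(** A lower closed set that contains i.1 contains kappa i.1, hence k.1, so the
    right side of i can be moved over to k. *)
Lemma basis_merge Sigma i k : implication_basis phi Sigma ->
    i \in Sigma -> k \in Sigma -> phi i.1 = E -> phi k.1 = E ->
    k.1 \subset kappa i.1 ->
  implication_basis phi ((k.1, k.2 :|: i.2) |: Sigma :\ k :\ i).
Proof.
move=> basisS Si Sk phiE phkE ski.
apply: (basis_modify basisS) => [j Sj pE|S FS j|S lcS obS j Sj].
- rewrite !in_setU1 !in_setD1 Sj andbT; apply/orP; right.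
  by apply/andP; split; apply: contraTneq pE => ->; rewrite ?phiE ?phkE properxx.
- rewrite in_setU1 !in_setD1 => /predU1P[->|/and3P[_ _]]; last exact: closed_obeys basisS FS.
  rewrite /obeys -implybE; apply/implyP => /= /(closure_sub FS).
  rewrite subUset phkE => sES.
  apply/andP; split; apply: subset_trans sES.
    by rewrite -phkE (basis_sub basisS).
  by rewrite -phiE (basis_sub basisS).
have := obS _ (setU11 _ _); rewrite /obeys -implybE /= subUset => /implyP obk.
have [->|njk] := eqVneq j k.
  by rewrite -implybE; apply/implyP=> /obk/andP[].
have [->|nji] := eqVneq j i; last by apply: obS; rewrite in_setU1 !in_setD1 njk nji Sj orbT.
rewrite -implybE; apply/implyP=> /(kappa_sub lcS)/(subset_trans ski).
by case/obk/andP.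
Qed.

Lemma basis_replace_left Sigma i A : implication_basis phi Sigma ->
    i \in Sigma -> phi i.1 = E -> kappa A = kappa i.1 ->
  implication_basis phi ((A, i.2) |: Sigma :\ i).
Proof.
move=> basisS Si phiE kA.
apply: (basis_modify basisS) => [j Sj pE|S FS j|S lcS obS j Sj].
- rewrite in_setU1 in_setD1 Sj andbT; apply/orP; right.
  by apply: contraTneq pE => ->; rewrite phiE properxx.
- rewrite in_setU1 in_setD1 => /predU1P[->|/andP[_]]; last exact: closed_obeys basisS FS.
  rewrite /obeys -implybE; apply/implyP => /= /(kappa_sub (closed_lower_closed FS)).
  rewrite kA => /(subset_trans (sub_kappa _)) siS.
  by have := closed_obeys basisS FS Si; rewrite /obeys siS.
have [->|nji] := eqVneq j i; last by apply: obS; rewrite in_setU1 in_setD1 nji Sj orbT.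
have := obS _ (setU11 _ _); rewrite /obeys -!implybE /= => /implyP obA.
apply/implyP=> /(kappa_sub lcS); rewrite -kA => /(subset_trans (sub_kappa _)).
exact: obA.
Qed.

End LowerClosedSets.

(** * The block at E of an optimal basis *)

Lemma leq_sum_setU (I : finType) (A B : {set I}) (F : I -> nat) :
  \sum_(i in A :|: B) F i <= \sum_(i in A) F i + \sum_(i in B) F i.
Proof.
rewrite (big_setID A) /= setUK leq_add2l.
rewrite setDUl setDv set0U [leqRHS](big_setID A) /=.
exact: leq_addl.
Qed.

Section OptimalBases.

Variables (X : finType) (phi : {set X} -> {set X}) (E : {set X}).
Hypothesis phi_closure : closure_operator phi.
Implicit Types (i j k : implication X) (Sigma T : {set implication X}).

Lemma optimal_kappa_neq Sigma i : optimal_basis phi Sigma ->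
  i \in Sigma -> phi i.1 = E -> i.1 != set0 -> kappa phi E i.1 != E.
Proof.
case=> basisS optS Si phiE; rewrite -card_gt0; apply: contraTneq => kE.
have := optS _ (basis_drop phi_closure basisS Si phiE kE).
rewrite /basis_size (big_setD1 i) //=.
by move: (\sum_(_ in _) _) => s; lia.
Qed.

(** Merging i into k saves the left side of i; this contradicts optimality only
    because that left side is nonempty. *)
Lemma optimal_kappa_unique Sigma i k : optimal_basis phi Sigma ->
    i \in Sigma -> k \in Sigma -> phi i.1 = E -> phi k.1 = E -> i.1 != set0 ->
  k.1 \subset kappa phi E i.1 -> k = i.
Proof.
case=> basisS optS Si Sk phiE phkE; rewrite -card_gt0 => i0 ski.
apply/eqP; apply: contraTT i0 => nki.
have := optS _ (basis_merge phi_closure basisS Si Sk phiE phkE ski).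
rewrite /basis_size => /leq_trans/(_ (leq_sum_setU _ _ _)).
rewrite big_set1 /= (big_setD1 k) //= (big_setD1 i) ?in_setD1 1?eq_sym ?nki //=.
have [leU _] := leq_card_setU k.2 i.2; move: leU.
by move: (\sum_(_ in _) _) #|k.1| #|k.2| #|i.1| #|i.2| #|_ :|: _|; lia.
Qed.

Lemma optimal_left_min Sigma i (A : {set X}) : optimal_basis phi Sigma ->
    i \in Sigma -> phi i.1 = E -> kappa phi E A = kappa phi E i.1 ->
  #|i.1| <= #|A|.
Proof.
case=> basisS optS Si phiE kA.
have := optS _ (basis_replace_left phi_closure basisS Si phiE kA).
rewrite /basis_size => /leq_trans/(_ (leq_sum_setU _ _ _)).
rewrite big_set1 /= (big_setD1 i) //=.
by move: (\sum_(_ in _) _) => s; lia.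
Qed.

(** Going from Sigma to T and back: kappa i.1 contains the left side of some j in
    the block of T, and kappa j.1 that of some k in the block of Sigma.  As k.1
    lies in kappa i.1, k is i, so the two kappas contain each other. *)
Lemma optimal_match Sigma T i :
    optimal_basis phi Sigma -> implication_basis phi T ->
    i \in Sigma -> phi i.1 = E -> i.1 != set0 ->
  exists2 j, j \in T & (phi j.1 == E) && (kappa phi E j.1 == kappa phi E i.1).
Proof.
move=> optS basisT Si phiE i0; have [basisS _] := optS.
have kiE := optimal_kappa_neq optS Si phiE i0.
have lci := lower_closed_kappa phi E i.1.
have [|j Tj /andP[/eqP phjE sji]] := violated_at phi_closure basisT lci _ kiE.
  by rewrite closure_kappa.
have skji := kappa_sub lci sji.
have skiE : kappa phi E i.1 \subset E by rewrite -{2}phiE kappa_sub_closure.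
have kjE : kappa phi E j.1 != E.
  by apply: contraNneq kiE => kjE; rewrite eqEsubset skiE -{1}kjE.
have [|k Sk /andP[/eqP phkE skj]] :=
    violated_at phi_closure basisS (lower_closed_kappa phi E j.1) _ kjE.
  by rewrite closure_kappa.
exists j; rewrite // phjE eqxx eqEsubset skji /=.
have eki := optimal_kappa_unique optS Si Sk phiE phkE i0 (subset_trans skj skji).
by rewrite kappa_sub ?lower_closed_kappa // -eki.
Qed.

Lemma optimal_left_le Sigma T :
    optimal_basis phi Sigma -> implication_basis phi T ->
  \sum_(i in Sigma | phi i.1 == E) #|i.1| <= \sum_(i in T | phi i.1 == E) #|i.1|.
Proof.
move=> optS basisT.
pose D := [set i in Sigma | (phi i.1 == E) && (i.1 != set0)].
pose m i j := [&& j \in T, phi j.1 == E & kappa phi E j.1 == kappa phi E i.1].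
pose f i := odflt i [pick j | m i j].
have fP i : i \in D -> m i (f i).
  rewrite inE => /and3P[Si /eqP phiE i0]; rewrite /f; case: pickP => //= nom.
  have [j Tj mj] := optimal_match optS basisT Si phiE i0.
  by have := nom j; rewrite /m Tj mj.
have injf : {in D &, injective f}.
  move=> i k Di Dk eqf.
  have /and3P[_ _ /eqP ki] := fP i Di; have /and3P[_ _ /eqP kk] := fP k Dk.
  move: Di Dk; rewrite !inE => /and3P[Si /eqP phiE i0] /and3P[Sk /eqP phkE k0].
  apply: (optimal_kappa_unique optS Sk Si) => //.
  by rewrite -kk -eqf ki sub_kappa.
(* Empty left sides have no matching implication but contribute nothing. *)
have -> : \sum_(i in Sigma | phi i.1 == E) #|i.1| = \sum_(i in D) #|i.1|.
  rewrite (bigID (fun i => i.1 == set0)) /= big1 ?add0n => [|i /andP[_ /eqP->]].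
    by apply: eq_bigl => i; rewrite inE andbA.
  exact: cards0.
apply: (@leq_trans (\sum_(i in D) #|(f i).1|)).
  apply: leq_sum => i Di; have /and3P[_ _ /eqP ki] := fP i Di.
  move: Di; rewrite inE => /and3P[Si /eqP phiE _].
  exact: optimal_left_min optS Si phiE ki.
rewrite -(big_imset (fun j => #|j.1|) injf) /=.
rewrite [leqRHS](bigID (mem (f @: D))) /=.
rewrite (eq_bigl (fun j => (j \in T) && (phi j.1 == E) && (j \in f @: D))) ?leq_addr //.
move=> j; rewrite andbC; case: imsetP => //= -[i Di ->].
by have /and3P[-> ->] := fP i Di.
Qed.

Lemma optimal_block_le Sigma T :
    optimal_basis phi Sigma -> implication_basis phi T ->
  \sum_(i in Sigma | phi i.1 == E) (#|i.1| + #|i.2|) <=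
  \sum_(i in T | phi i.1 == E) (#|i.1| + #|i.2|).
Proof.
case=> basisS optS basisT.
have := leq_trans (optS _ (basis_exchange E phi_closure basisS basisT))
  (leq_sum_setU _ _ _).
rewrite /basis_size (bigID (fun i => phi i.1 == E)) /= addnC.
by rewrite !(eq_bigl _ _ (fun i => in_set _ i)) leq_add2l.
Qed.

End OptimalBases.

Theorem corollary4 (X : finType) (phi : {set X} -> {set X}) (E : {set X})
    (Sigma Sigma' : {set implication X}) :
  0 < #|X| ->
  closure_operator phi ->
  essential phi E ->
  optimal_basis phi Sigma ->
  optimal_basis phi Sigma' ->
  \sum_(i in Sigma | phi i.1 == E) #|i.2| =
  \sum_(i in Sigma' | phi i.1 == E) #|i.2|.
Proof.
move=> _ clo _ optS optS'; have [[basisS _] [basisS' _]] := (optS, optS').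
have eq_left : \sum_(i in Sigma | phi i.1 == E) #|i.1| =
               \sum_(i in Sigma' | phi i.1 == E) #|i.1|.
  by apply/eqP; rewrite eqn_leq !optimal_left_le.
have : \sum_(i in Sigma | phi i.1 == E) (#|i.1| + #|i.2|) =
       \sum_(i in Sigma' | phi i.1 == E) (#|i.1| + #|i.2|).
  by apply/eqP; rewrite eqn_leq !optimal_block_le.
by rewrite !big_split /= eq_left => /addnI.
Qed.
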